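(* Let $P_k$ and $Q_k$ be the Rudin-Shapiro polynomials of degree $n-1$ with $n:=2^k$. Then $P_k$ and $Q_k$ have $o(n)$ zeros on the unit circle; that is, if $N(P_k)$ and $N(Q_k)$ denote the number of zeros (counted with multiplicities) of $P_k$ and $Q_k$, respectively, on $\{z\in\mathbb{C}:|z|=1\}$, then $$\lim_{k\to\infty}\frac{N(P_k)}{2^k}=\lim_{k\to\infty}\frac{N(Q_k)}{2^k}=0.$$
   Context: The Rudin-Shapiro polynomials are defined recursively by $P_0(z):=1$, $Q_0(z):=1$, and $$P_{k+1}(z):=P_k(z)+z^{2^k}Q_k(z),\qquad Q_{k+1}(z):=P_k(z)-z^{2^k}Q_k(z),\qquad k=0,1,2,\ldots.$$ Both $P_k$ and $Q_k$ are polynomials of degree $2^k-1$ with all coefficients in $\{-1,1\}$. *)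

(* Defs.v *)
From HB Require Import structures.
From mathcomp Require Import all_boot all_order all_algebra.
From mathcomp Require Import all_classical all_reals all_analysis.
From mathcomp Require Import complex.

Set Implicit Arguments.
Unset Strict Implicit.
Unset Printing Implicit Defensive.

Import Order.TTheory GRing.Theory Num.Theory.

Local Open Scope classical_set_scope.
Local Open Scope ring_scope.

Section RudinShapiro.
Variable A : nzRingType.

Fixpoint rudin_shapiro (k : nat) : {poly A} * {poly A} :=
  if k is j.+1 then
    let: (p, q) := rudin_shapiro j in
    (p + 'X^(2 ^ j) * q, p - 'X^(2 ^ j) * q)
  else (1, 1).

Definition rsP (k : nat) : {poly A} := (rudin_shapiro k).1.
Definition rsQ (k : nat) : {poly A} := (rudin_shapiro k).2.

End RudinShapiro.

Arguments rsP A k : clear implicits.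
Arguments rsQ A k : clear implicits.

Definition unit_circle (R : realType) : set R[i] := [set z | `|z| = 1].

Arguments unit_circle R _ : clear implicits.

(* A finitely supported sum: for p != 0, only the finitely many roots of p
   contribute (mup z p = 0 when p.[z] != 0). *)
Definition nb_zeros_circle (R : realType) (p : {poly R[i]}) : nat :=
  (\big[addn/0]_(z \in unit_circle R) mup z p)%N.

(* Main.v *)
Require Import Defs.
From HB Require Import structures.
From mathcomp Require Import all_boot all_order all_algebra.
From mathcomp Require Import all_classical all_reals all_analysis.
From mathcomp Require Import complex.
From mathcomp Require Import ring zify.

Set Implicit Arguments.
Unset Strict Implicit.
Unset Printing Implicit Defensive.

Import Order.TTheory GRing.Theory Num.Theory.
Import numFieldNormedType.Exports.

Local Open Scope classical_set_scope.
Local Open Scope ring_scope.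

(* Let z be a unimodular root of P_k (the case of Q_k is the same). Since the
   coefficients are real, 1/z is a root as well, and both are algebraic
   integers. Put b = ceil(k/2), c = floor(k/2), and unfold the recursion down to
   level b: P_k(z) = A P_b(z) + B Q_b(z), where AA* + BB* = 2^c and * denotes the
   same expression at 1/z. Together with P_b P_b* + Q_b Q_b* = 2^(b+1), the
   relations P_k(z) = P_k(1/z) = 0 force 2^c P_b P_b* = 2^(b+1) BB*, so that
   P_b(z) P_b(1/z) is divisible by 2 among the algebraic integers. As
   P_b = (X - s)^(2^b - 1) mod 2 for s = 1 or -1, the number
   (z - s)^(2 (2^b - 1)) is divisible by 2. On the other hand the product of
   s - z over all the roots z of P_k is P_k(s) up to sign, and P_k(1) = 2^b,
   Q_k(-1) = +-2^b. Hence there are at most 2 b (2^b - 1) = O(k 2^(k/2))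
   unimodular roots. *)

(** * Recursion, degrees and special values *)

Lemma rsPS (A : nzRingType) k :
  rsP A k.+1 = rsP A k + 'X^(2 ^ k) * rsQ A k.
Proof. by rewrite /rsP /rsQ /=; case: rudin_shapiro. Qed.

Lemma rsQS (A : nzRingType) k :
  rsQ A k.+1 = rsP A k - 'X^(2 ^ k) * rsQ A k.
Proof. by rewrite /rsP /rsQ /=; case: rudin_shapiro. Qed.

(** Squaring hides the signs of the leading coefficients; a square equal to 1 is all that
    integrality of the roots requires. *)
Lemma size_lead_rs (A : nzRingType) k :
  [/\ size (rsP A k) = (2 ^ k)%N, size (rsQ A k) = (2 ^ k)%N,
      lead_coef (rsP A k) ^+ 2 = 1 & lead_coef (rsQ A k) ^+ 2 = 1].
Proof.
elim: k => [|k [sP sQ lP lQ]].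
  by rewrite /rsP /rsQ /= size_poly1 lead_coef1 expr1n.
have Q0 : rsQ A k != 0 by rewrite -size_poly_eq0 sQ expn_eq0.
have sXQ : size ('X^(2 ^ k) * rsQ A k) = (2 ^ k.+1)%N.
  by rewrite size_monicM ?monicXn// size_polyXn sQ expnS; lia.
have lXQ : lead_coef ('X^(2 ^ k) * rsQ A k) = lead_coef (rsQ A k).
  by rewrite -(commr_polyXn (rsQ A k)) lead_coef_Mmonic ?monicXn.
have lt : (size (rsP A k) < size ('X^(2 ^ k) * rsQ A k)%R)%N.
  by rewrite sP sXQ ltn_exp2l.
rewrite rsPS rsQS; split.
- by rewrite addrC size_polyDl.
- by rewrite addrC size_polyDl size_polyN.
- by rewrite lead_coefDr// lXQ.
- by rewrite lead_coefDr ?size_polyN// lead_coefN sqrrN lXQ.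
Qed.

Lemma map_rs (A B : nzRingType) (f : {rmorphism A -> B}) k :
  map_poly f (rsP A k) = rsP B k /\ map_poly f (rsQ A k) = rsQ B k.
Proof.
elim: k => [|k [IHP IHQ]]; first by rewrite /rsP /rsQ /= rmorph1.
by rewrite !rsPS !rsQS rmorphD rmorphB rmorphM /= map_polyXn IHP IHQ.
Qed.

Lemma horner_rsPS (A : comNzRingType) k (z : A) :
  (rsP A k.+1).[z] = (rsP A k).[z] + z ^+ (2 ^ k) * (rsQ A k).[z].
Proof. by rewrite rsPS !hornerE. Qed.

Lemma horner_rsQS (A : comNzRingType) k (z : A) :
  (rsQ A k.+1).[z] = (rsP A k).[z] - z ^+ (2 ^ k) * (rsQ A k).[z].
Proof. by rewrite rsQS !hornerE. Qed.

(** Parallelogram law, with the inverse [y] in the role of the conjugate of [z]: each level doubles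
    the sum. *)
Lemma rs_norm (A : comNzRingType) (z y : A) k : z * y = 1 ->
  (rsP A k).[z] * (rsP A k).[y] + (rsQ A k).[z] * (rsQ A k).[y] = 2 ^+ k.+1.
Proof.
move=> zy; elim: k => [|k IH]; first by rewrite /rsP /rsQ /= !hornerE.
have uv : z ^+ (2 ^ k) * y ^+ (2 ^ k) = 1 by rewrite -exprMn zy expr1n.
rewrite !horner_rsPS !horner_rsQS [RHS]exprS -IH.
by ring: uv.
Qed.

Lemma rsP_at1 (A : comNzRingType) k : (rsP A k).[1] = 2 ^+ uphalf k.
Proof.
suff: (rsP A k).[1] = 2 ^+ uphalf k /\
      (rsQ A k).[1] = if odd k then 0 else 2 ^+ k./2 by case.
elim: k => [|k [IHP IHQ]]; first by rewrite /rsP /rsQ /= !hornerE.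
rewrite horner_rsPS horner_rsQS expr1n IHP IHQ /= uphalf_half.
by case: (odd k) => /=; rewrite ?mulr0 ?addr0 ?subr0 ?add0n ?add1n //
  mul1r ?subrr ?exprS; split => //; ring.
Qed.

Lemma rsQ_atN1 (A : comNzRingType) k :
  (rsQ A k).[-1] ^+ 2 = 2 ^+ (uphalf k).*2.
Proof.
case: k => [|k]; first by rewrite /rsQ /= !hornerE expr1n.
(* Only the first step of the recursion has the factor -1; from level 1 on, (-1)^(2^j) = 1, so the
   induction starts there. *)
suff [_ ->] : (rsP A k.+1).[-1] = (if odd k then 2 ^+ uphalf k else 0) /\
      (rsQ A k.+1).[-1] = (-1) ^+ odd k * 2 ^+ (k./2).+1.
  by rewrite exprMn -exprM mulnC exprM sqrrN !expr1n mul1r -exprM muln2.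
elim: k => [|k [IHP IHQ]].
  by rewrite /rsP /rsQ /= !hornerE /=; split; ring.
rewrite (horner_rsPS k.+1) (horner_rsQS k.+1) IHP IHQ /= uphalf_half.
have -> : (-1 : A) ^+ (2 ^ k.+1) = 1.
  by rewrite -signr_odd oddX /= expr0.
by case: (odd k) => /=; rewrite ?add0n ?add1n ?exprS ?expr1 ?expr0;
  split => //; ring.
Qed.

(** * Algebraic integers and powers of 2 *)

Local Notation algebraic_integer := (integralOver intr).

Section UnimodularRoots.
Variable C : numClosedFieldType.
Implicit Types (x y z s g h : C) (F : {poly C}).

Lemma algint_exp x n : algebraic_integer x -> algebraic_integer (x ^+ n).
Proof.
by move=> ix; elim: n => [|n IH]; rewrite ?exprS;
  [apply: integral1|apply: integral_mul].
Qed.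

Lemma algint_prod (r : seq C) (F : C -> C) :
  (forall x, x \in r -> algebraic_integer (F x)) ->
  algebraic_integer (\prod_(x <- r) F x).
Proof.
move=> iF; rewrite big_seq; apply: big_ind => //.
- exact: integral1.
- exact: integral_mul.
Qed.

Local Ltac algint := repeat first [exact: integral_nat | exact: integral1
  | exact: mxpoly.integral0 | assumption | apply: algint_exp
  | apply: integral_sub | apply: integral_add | apply: integral_opp
  | apply: integral_mul].

Lemma algint_mul2_neq1 h : algebraic_integer h -> 2 * h != 1.
Proof.
move=> [p mp /rootP ph]; apply/eqP => h2.
case: (posnP (size p)) => [/eqP|sp].
  by rewrite size_poly_eq0 (negPf (monic_neq0 mp)).
have sfp : size (map_poly intr p : {poly C}) = size p.
  by rewrite size_map_inj_poly//; apply: intr_inj.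
have lp : p`_(size p).-1 = 1 by rewrite -[RHS](monicP mp).
(* With n = deg p, 2^n p(1/2) = 0 is congruent to lead_coef p = 1 mod 2. *)
have [m hm] : exists m : int, 2 * m + 1 = 0.
  exists (\sum_(i < (size p).-1) p`_i * 2 ^+ ((size p).-1 - i.+1)).
  apply: (@intr_inj C); rewrite rmorphD rmorphM rmorph1 rmorph_sum /=.
  transitivity (2 ^+ (size p).-1 * (map_poly intr p).[h]); last first.
    by rewrite ph mulr0 rmorph0.
  rewrite horner_coef sfp -[in RHS](prednK sp) big_ord_recr /= mulrDr.
  rewrite !coef_map /= lp mul1r -exprMn h2 expr1n; congr (_ + _).
  rewrite !mulr_sumr; apply: eq_bigr => i _.
  rewrite coef_map /= rmorphM rmorphXn /=.
  have -> : 2 ^+ (size p).-1 = 2 * 2 ^+ ((size p).-1 - i.+1) * 2 ^+ i :> C.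
    by rewrite -exprS -exprD subnSK // subnK // ltnW.
  have hi : 2 ^+ i * h ^+ i = 1 by rewrite -exprMn h2 expr1n.
  by ring: hi.
by lia.
Qed.

(** If a < d, then 2^(d-a-1) g would be an algebraic integer equal to 1/2. *)
Lemma algint_dvd_exp2 a d g : algebraic_integer g ->
  2 ^+ a = 2 ^+ d * g -> (d <= a)%N.
Proof.
move=> ig eq; rewrite leqNgt; apply/negP => lt.
have /eqP[] : 2 * (2 ^+ (d - a.+1) * g) != 1.
  apply: algint_mul2_neq1.
  by apply: integral_mul ig; apply: algint_exp; apply: integral_nat.
apply: (@mulfI _ (2 ^+ a : C)); first by rewrite expf_neq0 ?pnatr_eq0.
by rewrite mulr1 [RHS]eq !mulrA -exprSr -exprD subnKC.
Qed.

Lemma algint_root_lead_sqr1 (p : {poly int}) z :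
  lead_coef p ^+ 2 = 1 -> root (map_poly intr p) z -> algebraic_integer z.
Proof.
move=> /eqP; rewrite sqrf_eq1 => /orP[] /eqP lp pz.
  by exists p; rewrite ?monicE ?lp.
exists (- p); first by rewrite monicE lead_coefN lp opprK.
by rewrite rmorphN /= rootN.
Qed.

(** * Reduction modulo 2 and descent *)

Lemma rs_mod2 s z b : s \in [:: 1; -1] -> algebraic_integer z ->
  (exists2 g, algebraic_integer g &
     (rsP C b).[z] = (z - s) ^+ (2 ^ b).-1 + 2 * g) /\
  (exists2 g, algebraic_integer g &
     (rsQ C b).[z] = (z - s) ^+ (2 ^ b).-1 + 2 * g).
Proof.
move=> sN1 iz.
have is_ : algebraic_integer s.
  by move: sN1; rewrite !inE => /orP[] /eqP->;
    [|apply: integral_opp]; apply: integral1.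
have iexp j : algebraic_integer (z ^+ j) by apply: algint_exp.
(* Frobenius modulo 2, where the sign of [s] disappears. *)
have frob j : exists2 h, algebraic_integer h &
    (z - s) ^+ (2 ^ j) = 1 + z ^+ (2 ^ j) + 2 * h.
  elim: j => [|j [h ih eq]].
    rewrite expn0 !expr1; move: sN1; rewrite !inE => /orP[] /eqP->.
      by exists (- 1); [apply/integral_opp/integral1|ring].
    by exists 0; [apply: mxpoly.integral0|ring].
  exists (z ^+ (2 ^ j) + 2 * h * (1 + z ^+ (2 ^ j)) + 2 * h ^+ 2).
    by algint.
  by rewrite expnSr !exprM eq; ring.
(* Modulo 2, both polynomials of level b+1 take the value (1 + z^(2^b)) (z - s)^(2^b - 1), whose
   first factor is (z - s)^(2^b). *)
elim: b => [|b [[g ig eP] [h ih eQ]]].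
  by rewrite /rsP /rsQ /= !hornerE; split; exists 0;
    rewrite ?mulr0 ?addr0; algint.
have [f if_ ef] := frob b.
have -> : (2 ^ b.+1).-1 = ((2 ^ b).-1 + 2 ^ b)%N.
  by rewrite expnS; have := expn_gt0 2 b; lia.
have im : algebraic_integer ((z - s) ^+ (2 ^ b).-1).
  by apply: algint_exp; apply: integral_sub.
rewrite horner_rsPS horner_rsQS eP eQ exprD ef; split.
  exists (g + z ^+ (2 ^ b) * h - (z - s) ^+ (2 ^ b).-1 * f); last by ring.
  by algint.
exists (g - z ^+ (2 ^ b) * h - (z - s) ^+ (2 ^ b).-1 * (z ^+ (2 ^ b) + f));
  last by ring.
by algint.
Qed.

(* With P, P' the values of P_b at z, y, and Q, Q' those of Q_b, the base case is
   (A A' + B B') P P' = B B' (Q Q' + P P'), by A P = - B Q and A' P' = - B' Q'.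
   The step from level b + c + 1 to b + c turns (A, B) into (A + B, u (A - B))
   with u = z^(2^(b+c)). *)
Lemma rs_descent z y b c d A A' B B' : z * y = 1 ->
  algebraic_integer z -> algebraic_integer y ->
  algebraic_integer B -> algebraic_integer B' ->
  algebraic_integer A -> algebraic_integer A' ->
  A * (rsP C (b + c)).[z] + B * (rsQ C (b + c)).[z] = 0 ->
  A' * (rsP C (b + c)).[y] + B' * (rsQ C (b + c)).[y] = 0 ->
  A * A' + B * B' = 2 ^+ d ->
  exists2 g, algebraic_integer g &
    2 ^+ (d + c) * ((rsP C b).[z] * (rsP C b).[y]) = 2 ^+ b.+1 * g.
Proof.
move=> zy iz iy; elim: c d A A' B B' => [|c IH] d A A' B B' iB iB' iA iA'.
  rewrite !addn0 => e e' nAB; exists (B * B'); first exact: integral_mul.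
  rewrite -nAB -(rs_norm b zy).
  have eA : A * (rsP C b).[z] = - (B * (rsQ C b).[z]).
    by apply/eqP; rewrite -addr_eq0 e.
  have eA' : A' * (rsP C b).[y] = - (B' * (rsQ C b).[y]).
    by apply/eqP; rewrite -addr_eq0 e'.
  have := congr2 *%R eA eA'; rewrite mulrNN => eAA'.
  by ring: eAA'.
rewrite addnS !horner_rsPS !horner_rsQS => e e' nAB.
set u := z ^+ (2 ^ (b + c)) in e *; set v := y ^+ (2 ^ (b + c)) in e' *.
have uv : u * v = 1 by rewrite -exprMn zy expr1n.
have iu : algebraic_integer u by apply: algint_exp.
have iv : algebraic_integer v by apply: algint_exp.
have := IH d.+1 (A + B) (A' + B') (u * (A - B)) (v * (A' - B')).
rewrite addSnnS; apply; try by algint.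
- by rewrite -e; ring.
- by rewrite -e'; ring.
- by rewrite exprS -nAB; ring: uv.
Qed.

(** * Unimodular roots and their number *)

Lemma rs_int k F : F \in [:: rsP C k; rsQ C k] ->
  exists2 f : {poly int}, F = map_poly intr f & lead_coef f ^+ 2 = 1.
Proof.
have [mP mQ] := map_rs (intr : {rmorphism int -> C}) k.
have [_ _ lP lQ] := size_lead_rs int k.
by rewrite !inE => /orP[] /eqP->; [exists (rsP int k)|exists (rsQ int k)].
Qed.

Lemma rs_unimodular_root_mod2 k F s z : F \in [:: rsP C k; rsQ C k] ->
    s \in [:: 1; -1] -> `|z| = 1 -> root F z ->
  exists2 g, algebraic_integer g & (z - s) ^+ (2 ^ uphalf k).-1.*2 = 2 * g.
Proof.
move=> Fk sN1 z1 Fz.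
have [f Ff lf] := rs_int Fk.
have Fzc : root F z^*.
  have [mP mQ] := map_rs (Num.conj : {rmorphism C -> C}) k.
  have <- : map_poly Num.conj F = F.
    by move: Fk; rewrite !inE => /orP[] /eqP->.
  by rewrite fmorph_root.
have zy : z * z^* = 1 by rewrite -normCK z1 expr1n.
have iz : algebraic_integer z.
  by move: Fz; rewrite Ff; apply: algint_root_lead_sqr1.
have iy : algebraic_integer z^*.
  by move: Fzc; rewrite Ff; apply: algint_root_lead_sqr1.
set y := z^* in zy iy Fzc *; set b := uphalf k.
have kE : k = (b + k./2)%N by rewrite /b uphalf_half -addnA addnn odd_double_half.
have [g ig eg] : exists2 g, algebraic_integer g &
    2 ^+ k./2 * ((rsP C b).[z] * (rsP C b).[y]) = 2 ^+ b.+1 * g.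
  (* The descent starts from (A, B) = (1, 0) for P_k and (0, 1) for Q_k, with A A' + B B' = 2^0. *)
  move: Fk Fz Fzc; rewrite !inE {1 2}kE => /orP[] /eqP-> /rootP Fz /rootP Fy.
    apply: (@rs_descent z y b k./2 0 1 1 0 0) => //; algint.
    - by rewrite mul1r mul0r addr0.
    - by rewrite mul1r mul0r addr0.
    - by rewrite mul1r mul0r addr0.
  apply: (@rs_descent z y b k./2 0 0 0 1 1) => //; algint.
  - by rewrite mul1r mul0r add0r.
  - by rewrite mul1r mul0r add0r.
  - by rewrite mul1r mul0r add0r.
have is_ : algebraic_integer s.
  by move: sN1; rewrite !inE => /orP[] /eqP->; algint.
have ss : s * s = 1.
  by move: sN1; rewrite !inE => /orP[] /eqP->; rewrite ?mulrNN mulr1.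
(* With c = [k./2], cancelling 2^c leaves 2^(b+1-c) = 2^(1 + [odd k]); [uphalf k] is the least level
   b that keeps a factor 2. *)
have {}eg : (rsP C b).[z] * (rsP C b).[y] = 2 * (2 ^+ odd k * g).
  apply: (@mulfI _ (2 ^+ k./2 : C)); first by rewrite expf_neq0 ?pnatr_eq0.
  rewrite eg !mulrA -exprSr -exprD; congr (2 ^+ _ * _).
  by rewrite /b uphalf_half addSn addnC.
have [[h ih eh] _] := rs_mod2 b sN1 iz.
have [[h' ih' eh'] _] := rs_mod2 b sN1 iy.
move: eg; rewrite eh eh'; set m := (2 ^ b).-1 => eg.
(* From z y = 1 and s^2 = 1 follows z - s = (y - s)(- s z), which turns (z - s)^(2m) into (z - s)^m
   (y - s)^m times a power of - s z. The first factor of the witness solves [eg] for half of that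
   product. *)
exists ((2 ^+ odd k * g - h * (y - s) ^+ m - (z - s) ^+ m * h' - 2 * h * h')
  * (- s * z) ^+ m).
  by algint.
have -> : (z - s) ^+ m.*2 = (z - s) ^+ m * (y - s) ^+ m * (- s * z) ^+ m.
  rewrite -addnn exprD -mulrA; congr (_ * _); rewrite -exprMn.
  by congr (_ ^+ _); ring: zy ss.
move: eg; set X := (z - s) ^+ m; set Y := (y - s) ^+ m => eg.
have -> : X * Y = 2 * (2 ^+ odd k * g) - 2 * h * Y - X * (2 * h')
    - 2 * h * (2 * h').
  by rewrite -eg; ring.
by ring.
Qed.

(** F(s)^2 is the product of (z - s)^2 over the roots. In its power of exponent 2^b - 1, b =
    [uphalf k], each unimodular root contributes a factor 2, and the cofactor is an algebraic
    integer. *)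
Lemma rs_count_unimodular k F s (r : seq C) : F \in [:: rsP C k; rsQ C k] ->
    F = lead_coef F *: \prod_(x <- r) ('X - x%:P) ->
    s \in [:: 1; -1] -> F.[s] ^+ 2 = 2 ^+ (uphalf k).*2 ->
  (count (fun z => `|z| == 1)%R r <= (uphalf k).*2 * (2 ^ uphalf k).-1)%N.
Proof.
move=> Fk Fr sN1 Fs.
have [f Ff lf] := rs_int Fk.
have l1 : lead_coef F ^+ 2 = 1.
  rewrite Ff lead_coef_map_inj ?rmorph0//; last exact: intr_inj.
  by rewrite -rmorphXn lf.
have l0 : lead_coef F != 0.
  by apply: contra_eq_neq l1 => ->; rewrite expr0n eq_sym oner_eq0.
have rE z : z \in r -> root F z.
  by move=> zr; rewrite Fr rootZ// root_prod_XsubC.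
have is_ : algebraic_integer s.
  by move: sN1; rewrite !inE => /orP[] /eqP->; algint.
set m := (2 ^ uphalf k).-1.
pose G z := (z - s) ^+ m.*2 / 2 ^+ (`|z| == 1).
have GE z : (z - s) ^+ m.*2 = 2 ^+ (`|z| == 1) * G z.
  by rewrite mulrC divfK// expf_neq0 ?pnatr_eq0.
apply: (@algint_dvd_exp2 _ _ (\prod_(z <- r) G z)).
  apply: algint_prod => z zr; rewrite /G; case: eqP => z1 /=.
    have [g ig ->] := rs_unimodular_root_mod2 Fk sN1 z1 (rE z zr).
    by rewrite mulrC mulKf// pnatr_eq0.
  rewrite divr1; apply: algint_exp; apply: integral_sub => //.
  by move: (rE z zr); rewrite Ff; apply: algint_root_lead_sqr1.
have {}Fs : \prod_(z <- r) (z - s) ^+ 2 = 2 ^+ (uphalf k).*2.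
  rewrite -Fs Fr hornerZ exprMn l1 mul1r horner_prod -prodrXl.
  by apply: eq_bigr => z _; rewrite hornerXsubC -sqrrN opprB.
rewrite exprM -Fs -prodrXl.
have -> : 2 ^+ count (fun z => `|z| == 1) r =
    \prod_(z <- r) 2 ^+ (`|z| == 1) :> C.
  by rewrite prodrXr -sum1_count big_mkcond.
rewrite -big_split /=.
by apply: eq_bigr => z _; rewrite -exprM mul2n GE.
Qed.

End UnimodularRoots.

(** * Zero counts and the limit *)

Lemma nb_zeros_circleE (R : realType) (F : {poly R[i]}) (r : seq R[i]) :
  F != 0 -> F = lead_coef F *: \prod_(x <- r) ('X - x%:P) ->
  nb_zeros_circle F = count (fun z => `|z| == 1) r.
Proof.
move=> F0 Fr; rewrite /nb_zeros_circle -size_filter.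
set t := [seq z <- r | `|z| == 1].
have mupE z : mup z F = count_mem z r.
  by rewrite Fr -mul_polyC mupMr ?mu_prod_XsubC// rootC lead_coef_eq0.
rewrite (fsbigE (undup t)) ?undup_uniq//.
(* Equal entries of [t] are grouped, so that its size becomes a sum of multiplicities over distinct
   roots. *)
- rewrite -[RHS](perm_size (perm_count_undup t)) size_flatten /shape -map_comp.
  rewrite sumnE big_map big_mkcond /= [LHS]big_seq [RHS]big_seq.
  apply: eq_bigr => z; rewrite mem_undup mem_filter => /andP[/eqP z1 zr].
  rewrite size_nseq mem_set//= mupE count_filter; apply: eq_count => x /=.
  by case: eqP => // ->; rewrite z1 eqxx.
- by move=> z /=; rewrite mem_undup mem_filter => /andP[/eqP].
- move=> z z1; rewrite mem_undup mem_filter z1 eqxx /= mupE.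
  by move/count_memPn.
Qed.

Lemma nb_zeros_rs_le (R : realType) k :
  (nb_zeros_circle (rsP R[i] k) <= (uphalf k).*2 * (2 ^ uphalf k).-1)%N /\
  (nb_zeros_circle (rsQ R[i] k) <= (uphalf k).*2 * (2 ^ uphalf k).-1)%N.
Proof.
have main s F : F \in [:: rsP R[i] k; rsQ R[i] k] -> s \in [:: 1; -1] ->
    F.[s] ^+ 2 = 2 ^+ (uphalf k).*2 ->
    (nb_zeros_circle F <= (uphalf k).*2 * (2 ^ uphalf k).-1)%N.
  move=> Fk sN1 Fs.
  have [r Fr] := closed_field_poly_normal F.
  rewrite (nb_zeros_circleE _ Fr); first exact: rs_count_unimodular Fr sN1 Fs.
  apply: contra_eq_neq Fs => ->.
  by rewrite horner0 expr0n eq_sym expf_neq0 ?pnatr_eq0.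
(* The point [s] depends on the polynomial, since P_k(-1) = Q_k(1) = 0 for odd k. *)
split; [apply: (main 1)|apply: (main (-1))]; rewrite ?inE ?eqxx ?orbT//.
- by rewrite rsP_at1 -exprM muln2.
- exact: rsQ_atN1.
Qed.

Lemma leq_mulnS_exp2 n : (n * n.+1 <= 2 ^ n.+1)%N.
Proof.
(* The step needs n + 2 <= 2 n, hence the separate small cases. *)
elim: n => // n IH; case: n IH => [|[|n]] // IH.
by rewrite expnS; nia.
Qed.

Lemma rs_bound_div (R : realType) k :
  ((uphalf k).*2 * (2 ^ uphalf k).-1)%:R / 2 ^+ k <= 16 * k.+1%:R^-1 :> R.
Proof.
set b := uphalf k.
have hk : (k = b.*2 \/ k.+1 = b.*2)%N by rewrite /b; lia.
rewrite ler_pdivrMr ?exprn_gt0// mulrAC ler_pdivlMr ?ltr0n//.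
rewrite -natrX -!natrM ler_nat.
have h1 := leq_mulnS_exp2 b.
have h2 : (2 ^ b * 2 ^ b <= 2 * 2 ^ k)%N by rewrite -expnD -expnS leq_exp2l//; lia.
rewrite expnS in h1.
have : ((2 ^ b).-1 <= 2 ^ b)%N by lia.
move: h1 h2; set B := (2 ^ b)%N; set K := (2 ^ k)%N => h1 h2 h3.
have hk2 : (k.+1 <= b.*2.+1)%N by lia.
(* The constant 16: 2b (2b+1) B <= 4 b (b+1) B <= 8 B^2 <= 16 K. *)
apply: (@leq_trans (b.*2 * B * b.*2.+1)).
  by rewrite leq_mul// leq_mul.
nia.
Qed.

Theorem theorem2p1 (R : realType) :
  ((fun k : nat => (nb_zeros_circle (rsP R[i] k))%:R / 2 ^+ k : R) @ \oo
     --> (0 : R)) /\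
  ((fun k : nat => (nb_zeros_circle (rsQ R[i] k))%:R / 2 ^+ k : R) @ \oo
     --> (0 : R)).
Proof.
have squeeze (N : nat -> nat) :
    (forall k, N k <= (uphalf k).*2 * (2 ^ uphalf k).-1)%N ->
    (fun k : nat => (N k)%:R / 2 ^+ k : R) @ \oo --> (0 : R).
  move=> Nle; apply: (squeeze_cvgr (f := cst 0) (h := fun k => 16 * harmonic k)).
  - apply: nearW => k; rewrite divr_ge0 ?exprn_ge0//=.
    apply: le_trans (rs_bound_div R k).
    by rewrite ler_wpM2r ?invr_ge0 ?exprn_ge0// ler_nat.
  - exact: cvg_cst.
  - by rewrite -[0](mulr0 16); apply: cvgM; [exact: cvg_cst|exact: cvg_harmonic].
by split; apply: squeeze => k; have [] := nb_zeros_rs_le R k.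
Qed.
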